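(* For every integer $m\geq 2$ and every $\varepsilon>0$ there exist a constant $K=K(\varepsilon,m)$ and a set $E\subseteq\mathbb{N}$ such that $$r_N^{(m)}(E)<K\quad\text{for all } N\in\mathbb{Z},$$ and $$\mathrm{card}\left(E\cap\{1,2,\dots,n\}\right)\gg n^{\frac1m-\varepsilon}\quad\text{for all sufficiently large } n,$$ i.e. there are $c>0$ and $n_0$ with $\mathrm{card}(E\cap\{1,\dots,n\})\geq c\,n^{\frac1m-\varepsilon}$ for all $n\geq n_0$.
   Context: $\mathbb{N}=\{1,2,3,\dots\}$. For $E\subseteq\mathbb{N}$, $m\ge 2$ and $N\in\mathbb{Z}$, $r_N^{(m)}(E)$ is the number of ways to represent $N$ as any combination of sums and differences of $m$ distinct elements of $E$. Precisely, $r_N^{(m)}(E)=\sum_{t=0}^m r_{N,t}^{(m)}(E)$, where $r_{N,t}^{(m)}(E)$ is the number of tuples $(a_1,\dots,a_m)\in E^m$ with $\sum_{i=1}^t a_i-\sum_{i=t+1}^m a_i=N$, $a_1<\cdots<a_t$, $a_{t+1}<\cdots<a_m$, and $a_i\neq a_j$ for $i\neq j$ (for $t=0$ the equation is $-\sum_{i=1}^m a_i=N$ and for $t=m$ it is $\sum_{i=1}^m a_i=N$, with $a_1<\cdots<a_m$ in both cases). *)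

(* Defs.v *)
From HB Require Import structures.
From mathcomp Require Import all_boot all_order all_algebra.
From mathcomp Require Import finmap.
From mathcomp Require Import all_classical all_reals all_analysis.

Set Implicit Arguments.
Unset Strict Implicit.
Unset Printing Implicit Defensive.

Import Order.TTheory GRing.Theory Num.Theory.

Local Open Scope classical_set_scope.
Local Open Scope ring_scope.

(* Indices are shifted by one: [a i] for [i : 'I_m] is the paper's a_(i+1), so
   the positive terms a_1, ..., a_t are those with [i < t]. *)
Definition repr_tuples (m t : nat) (E : set nat) (N : int) :
    set {ffun 'I_m -> nat} :=
  [set a : {ffun 'I_m -> nat} |
    [/\ forall i : 'I_m, E (a i),
        \sum_(i < m | (i < t)%N) (a i)%:Z
          - \sum_(i < m | (t <= i)%N) (a i)%:Z = N,
        forall i j : 'I_m, (i < j)%N -> (j < t)%N -> (a i < a j)%N,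
        forall i j : 'I_m, (t <= i)%N -> (i < j)%N -> (a i < a j)%N
      & forall i j : 'I_m, i != j -> a i != a j]].

Arguments repr_tuples : clear implicits.

(* Extended-real valued: a representation number is [+oo] when there are
   infinitely many representations. *)
Definition repr_count (R : realType) (m : nat) (E : set nat) (N : int) :
    \bar R :=
  (\sum_(t < m.+1) counting (repr_tuples m t E N))%E.

Arguments repr_count : clear implicits.

Definition initial_card (E : set nat) (n : nat) : nat :=
  #|` fset_set (E `&` [set k | (1 <= k <= n)%N])|%fset.

(* Main.v *)
Require Import Defs.
From HB Require Import structures.
From mathcomp Require Import all_boot all_order all_algebra.
From mathcomp Require Import finmap.
From mathcomp Require Import all_classical all_reals all_analysis.
From mathcomp Require Import zify ring lra.

(** The set is a union of finite blocks chosen by counting. Fix a large integer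
    [s] and put [k_j = q_j ^ s], [X_j = q_j ^ (m s + 1)] with [q_j = b ^ e_j].
    Block [j] consists of [k_j] integers in [[1, X_j]], and the exponents satisfy
    both [s e_(j+1) <= (s + 1) e_j] and [e_(j + s) = 2 e_j]. The first fact gives
    the density: for [X_j <= n < X_(j+1)] the set has at least [k_j >= n ^ x]
    elements up to [n], where [x = s^2 / ((m s + 1) (s + 1))] tends to [1 / m]
    as [s] grows ([exponent_close]). The second one makes the scales [X_j]
    doubly exponential in [j], so that boundedly many blocks matter for a
    given [N].

    One block. Let [F] be the union of the earlier blocks, of size at most [k],
    and draw the new block uniformly at random in [[1, X]]. There are at most
    [m (4 k) ^ m] signed formulas of length between [1] and [m], and a formula
    that involves a new element takes a prescribed value with probability at
    most [1 / X], since the other elements determine the new one. As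
    [X / k ^ m = q], a power saving results, with two consequences
    ([good_assignment], [good_block_exists]):
    - no formula with a new element has a small value, [|N| <= Z];
    - [D] formulas with new elements and pairwise disjoint supports do not all
      take the same value. Disjointness makes the constraints independent, and
      [D] of them beat the number [(4 k) ^ (m D)] of families once [D] is large
      in terms of [m] and [s]. Asking for equal sums, not for a given sum [N],
      costs one factor [X] and spares a union over [N].
    No randomness from one block is used in the next, because [F] is arbitrary.

    All blocks. Let [N] be given, and call a block active if it contains the
    last element, in block order, of some representation of [N]. Then
    [Z_j < |N| <= m X_j], so the active blocks lie in a window of bounded
    length. Within one block, a maximal family of disjoint representations has
    fewer than [D] members, and every representation meets it. So a set of
    bounded size meets all representations of [N] of a given length
    ([blocks_hitting]). Removing an element of that set from a representation
    leaves a shorter one, of one of boundedly many integers, and induction on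
    the length bounds the number of representations ([rep_count_le]). *)

Set Implicit Arguments.
Unset Strict Implicit.
Unset Printing Implicit Defensive.

Import Order.TTheory GRing.Theory Num.Theory.

Local Open Scope classical_set_scope.
Local Open Scope ring_scope.

(** * Signed sums *)

(** A formula is a list of pairs (sign, label), the sign [true] standing for
    minus. Labels are valued by [v], so that one formula can be evaluated at
    all choices of a random block. *)
Definition signed_sum (T : Type) (v : T -> nat) (w : seq (bool * T)) : int :=
  \sum_(x <- w) (-1) ^+ x.1 * (v x.2)%:Z.

Lemma signed_sum_map (T U : Type) (f : T -> U) (v : U -> nat) (w : seq (bool * T)) :
  signed_sum v [seq (x.1, f x.2) | x <- w] = signed_sum (v \o f) w.
Proof. by rewrite /signed_sum big_map. Qed.

Lemma eq_signed_sum (T : eqType) (u v : T -> nat) (w : seq (bool * T)) :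
  {in unzip2 w, u =1 v} -> signed_sum u w = signed_sum v w.
Proof.
move=> uv; rewrite /signed_sum big_seq [RHS]big_seq; apply: eq_bigr => x xw.
by rewrite uv // map_f.
Qed.

(** A label occurring once in a formula has coefficient [1] or [-1], so its value
    is determined by the sum and the other values. *)
Lemma signed_sum_inj_at (T : eqType) (u v : T -> nat) (w : seq (bool * T)) (p : T) :
    uniq (unzip2 w) -> p \in unzip2 w -> (forall q, q != p -> u q = v q) ->
  signed_sum u w = signed_sum v w -> u p = v p.
Proof.
elim: w => //= -[b q] w IH /= /andP[qw uw].
rewrite inE /signed_sum !big_cons /= -!/(signed_sum _ _).
have [-> _ uv|pq /= pw uv] := eqVneq p q.
  have -> : signed_sum u w = signed_sum v w.
    by apply: eq_signed_sum => r rw; apply: uv; apply: contraNneq qw => <-.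
  by case: b => /addIr; rewrite ?expr0 ?expr1 ?mul1r ?mulN1r; first move/oppr_inj; case.
by rewrite (uv q) 1?eq_sym // => /addrI; apply: IH.
Qed.

Lemma absz_signed_sum_le (T : eqType) (v : T -> nat) (w : seq (bool * T)) (X : nat) :
  {in unzip2 w, forall a, (v a <= X)%N} -> (`|signed_sum v w| <= size w * X)%N.
Proof.
elim: w => [|[b a] w IH] /= vX; first by rewrite /signed_sum big_nil.
rewrite /signed_sum big_cons -/(signed_sum v w) /= mulSn.
have := IH (fun c cw => vX c (mem_behead (s := _ :: _) cw)).
have := vX a (mem_head _ _).
by case: b; rewrite ?expr0 ?expr1; lia.
Qed.

(** * Counting by overwriting a coordinate *)

(** The union bound, with a common factor [a] kept on the left to avoid
    division. *)
Lemma card_exists_le (G T : finType) (P : T -> pred G) (a b : nat) :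
    (forall x, #|P x| * a <= b)%N ->
  (#|[pred g | [exists x, P x g]]| * a <= #|T| * b)%N.
Proof.
move=> Pab; apply: (@leq_trans ((\sum_x #|P x|) * a)); last first.
  by rewrite big_distrl -sum_nat_const; apply: leq_sum => x _; apply: Pab.
rewrite leq_mul2r; apply/orP; right.
rewrite -sum1_card; under [leqRHS]eq_bigr do rewrite -sum1_card big_mkcond.
rewrite exchange_big big_mkcond leq_sum // => g _ /=; rewrite inE.
case: ifP => // /existsP[x Px]; rewrite (bigD1 x) //= unfold_in Px; lia.
Qed.

Section Overwrite.
Variables (I Y C : finType).
Implicit Types g h : {ffun I -> Y}.

Definition overwrite g (i : I) (y : Y) : {ffun I -> Y} :=
  [ffun j => if j == i then y else g j].

(** Probabilities decrease by a factor [#|C| / #|Y|] when a constraint determines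
    coordinate [i], up to [#|C|] possibilities recorded by [c]: the map
    [(g, y) |-> (overwrite g i y, c g)] is then injective on [S * Y]. *)
Lemma card_overwrite (S S' : pred {ffun I -> Y}) (i : I) (c : {ffun I -> Y} -> C) :
    (forall g y, S g -> S' (overwrite g i y)) ->
    (forall g h, S g -> S h -> (forall j, j != i -> g j = h j) -> c g = c h ->
       g i = h i) ->
  (#|S| * #|Y| <= #|S'| * #|C|)%N.
Proof.
move=> SS' Sdet.
have -> : (#|S| * #|Y|)%N = #|[predX S & predT : pred Y]| by rewrite cardX.
have -> : (#|S'| * #|C|)%N = #|[predX S' & predT : pred C]| by rewrite cardX.
pose f (u : {ffun I -> Y} * Y) := (overwrite u.1 i u.2, c u.1).
rewrite -(@card_in_image _ _ f) => [|[g y] [h z]]; last first.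
  rewrite !inE /= !andbT => Sg Sh [/ffunP ov cgh].
  have := ov i; rewrite !ffunE eqxx => ->.
  have off j : j != i -> g j = h j by move=> ji; have := ov j; rewrite !ffunE (negPf ji).
  congr (_, _); apply/ffunP => j; have [->|] := eqVneq j i; last exact: off.
  exact: Sdet.
apply/subset_leq_card/fintype.subsetP => _ /fintype.imageP[[g y] /= Sg ->].
by move: Sg; rewrite !inE /= !andbT; apply: SS'.
Qed.
End Overwrite.

(** * A random block *)

Definition disjoint_labels (T : eqType) (w w' : seq (bool * T)) : bool :=
  ~~ has (mem (unzip2 w)) (unzip2 w').

Section RandomBlock.
Variables (p k X : nat) (f : 'I_p -> nat).
Local Notation L := ('I_p + 'I_k)%type.
Implicit Types (g h : {ffun 'I_k -> 'I_X}) (w : seq (bool * L)).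

Definition label_value g (x : L) : nat :=
  match x with inl a => f a | inr i => (g i).+1 end.

Definition is_new (x : L) : bool := if x is inr _ then true else false.

Definition admissible w := uniq (unzip2 w) && has is_new (unzip2 w).

Lemma admissibleP w :
  admissible w -> exists2 i, uniq (unzip2 w) & inr i \in unzip2 w.
Proof. by case/andP=> uw /hasP[[//|i] iw _]; exists i. Qed.

Lemma label_value_overwrite g i y x :
  x != inr i -> label_value (overwrite g i y) x = label_value g x.
Proof.
by case: x => //= j ji; rewrite ffunE ifN //; apply: contraNneq ji => ->.
Qed.

Lemma label_value_det g h w i : uniq (unzip2 w) -> inr i \in unzip2 w ->
    (forall j, j != i -> g j = h j) ->
    signed_sum (label_value g) w = signed_sum (label_value h) w ->
  g i = h i.
Proof.
move=> uw iw gh e; apply/val_inj/succn_inj.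
apply: (@signed_sum_inj_at _ (label_value g) (label_value h) w (inr i)) => // -[//|j] ji /=.
by rewrite gh //; apply: contraNneq ji => ->.
Qed.

(** At most [2 Z + 1] values of a new label are compatible with a sum in
    [[-Z, Z]], the other values being given. *)
Lemma card_small_sum w Z : admissible w ->
  (#|[pred g | (`|signed_sum (label_value g) w| <= Z)%N]| * X <= X ^ k * Z.*2.+1)%N.
Proof.
case/admissibleP=> i uw iw.
have := @card_overwrite _ _ 'I_Z.*2.+1
  [pred g | (`|signed_sum (label_value g) w| <= Z)%N] predT i
  (fun g => inord (absz (signed_sum (label_value g) w + Z%:Z))).
rewrite !card_ord card_ffun !card_ord; apply => // g h /=.
move=> gZ hZ gh /(congr1 (@nat_of_ord _)); rewrite !inordK; try lia.
by move=> e; apply: (label_value_det uw iw gh); lia.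
Qed.

(** Each formula contains a new label that the later formulas do not use, so the
    constraint that its sum equals theirs costs a factor [X] independently of
    the constraints among the later ones. The last formula is free, hence the
    predecessor. *)
Lemma card_equal_sums (ws : seq (seq (bool * L))) :
    all admissible ws -> pairwise (@disjoint_labels _) ws ->
  (#|[pred g | constant [seq signed_sum (label_value g) w | w <- ws]]| * X ^ (size ws).-1
     <= X ^ k)%N.
Proof.
have top (P : pred {ffun 'I_k -> 'I_X}) : (#|P| * X ^ 0 <= X ^ k)%N.
  by rewrite muln1 (leq_trans (max_card _)) // card_ffun !card_ord.
elim: ws => [|w [|w' ws] IH]; [by move=> _ _; apply: top..|].
move=> /= /andP[/admissibleP[i uw iw] adm] /andP[dw dis].
apply: leq_trans (IH adm dis) => /=.
rewrite expnS mulnA leq_mul2r; apply/orP; right.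
have /(@allP _ _ _) dwP : all (disjoint_labels w) (w' :: ws) := dw.
have constP u us g :
    reflect {in us, forall v, signed_sum (label_value g) v = signed_sum (label_value g) u}
      (constant [seq signed_sum (label_value g) v | v <- u :: us]).
  rewrite /= all_map; apply: (iffP allP) => e v vus; first exact/eqP/e.
  by rewrite /= e.
set S' := (X in (_ <= #|X|)%N); set S := (X in (#|X| * _ <= _)%N).
have := @card_overwrite _ _ unit S S' i (fun=> tt).
rewrite card_unit muln1 card_ord; apply.
- move=> g y /(constP w (w' :: ws) g) e; apply/(constP w' ws).
  have ow u : u \in w' :: ws ->
      signed_sum (label_value (overwrite g i y)) u = signed_sum (label_value g) u.
    move=> uws; apply: eq_signed_sum => x xu; apply: label_value_overwrite.
    apply: contraTneq xu => ->; have := dwP u uws.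
    by apply: contra => iu; apply/hasP; exists (inr i).
  move=> u uws; have uws' : u \in w' :: ws by rewrite inE uws orbT.
  by rewrite (ow u uws') (ow w' (mem_head _ _)) (e u uws') (e w' (mem_head _ _)).
- move=> g h /(constP w (w' :: ws) g) eg /(constP w (w' :: ws) h) eh gh _.
  apply: (label_value_det uw iw gh).
  rewrite -(eg w') ?mem_head // -(eh w') ?mem_head //.
  apply: eq_signed_sum => -[//|j] jw' /=; rewrite gh //; apply: contraTneq jw' => ->.
  have := dwP w' (mem_head _ _); apply: contra => iw'.
  by apply/hasP; exists (inr i).
Qed.

Lemma card_terms : (p <= k)%N -> (#|{: bool * L}| <= 4 * k)%N.
Proof. by move=> pk; rewrite card_prod card_bool card_sum !card_ord; lia. Qed.

(** Families of [D] formulas of a common length between [1] and [m], as a finite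
    type to sum over. *)
Definition formulas (D m : nat) : finType :=
  {i : 'I_m & Finite.sort (D.-tuple (i.+1.-tuple (bool * L)) : finType)}.

Lemma card_formulas (m D : nat) : (0 < k)%N -> (p <= k)%N ->
  (#|formulas D m| <= m * (4 * k) ^ (m * D))%N.
Proof.
move=> k0 pk; rewrite card_tagged sumnE big_map big_enum /=.
rewrite -[X in (_ <= X * _)%N](card_ord m) -sum_nat_const; apply: leq_sum => i _.
rewrite !card_tuple -expnM.
apply: (@leq_trans ((4 * k) ^ (i.+1 * D))).
  by case: (_ * D)%N => // e; rewrite leq_exp2r // card_terms.
by rewrite leq_pexp2l ?leq_mul2r ?ltn_ord ?orbT //; lia.
Qed.

Definition unpack (D m : nat) (u : formulas D m) : seq (seq (bool * L)) :=
  [seq (tval w) | w : (tag u).+1.-tuple (bool * L) <- tval (tagged u)].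

Lemma unpackP (D m l : nat) (ws : seq (seq (bool * L))) : (0 < k)%N ->
    size ws = D -> (0 < l <= m)%N -> {in ws, forall w, size w = l} ->
  exists u : formulas D m, unpack u = ws.
Proof.
move=> k0 sD; case: l => // l lm sl.
pose wt := insubd (nseq_tuple l.+1 (true, inr (Ordinal k0) : L)).
have swt : size (map wt ws) == D by rewrite size_map sD.
exists (existT _ (Ordinal lm) (Tuple swt)); rewrite /unpack /= -map_comp.
rewrite -[RHS]map_id; apply/eq_in_map => w /sl sw.
by rewrite /= insubdK // unfold_in sw.
Qed.

Lemma size_unpack D m (u : formulas D m) : size (unpack u) = D.
Proof. by rewrite size_map size_tuple. Qed.

Lemma admissible_size w : admissible w -> (0 < size w)%N.
Proof. by case/admissibleP=> i _; case: w. Qed.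

(** Each of the two bad events has probability less than [1 / 2], by the union
    bound over formulas, respectively over families of [D] formulas. *)
Lemma good_assignment (m D Z : nat) : (0 < D)%N -> (0 < k)%N -> (p <= k)%N ->
    (2 * (m * (4 * k) ^ m) * Z.*2.+1 < X)%N ->
    (2 * (m * (4 * k) ^ (m * D)) < X ^ D.-1)%N ->
  exists g,
    (forall w, admissible w -> (size w <= m)%N ->
       (Z < `|signed_sum (label_value g) w|)%N) /\
    (forall (ws : seq (seq (bool * L))) (l : nat) (N : int),
       size ws = D -> (l <= m)%N ->
       {in ws, forall w,
          [/\ admissible w, size w = l & signed_sum (label_value g) w = N]} ->
       ~~ pairwise (@disjoint_labels _) ws).
Proof.
move=> D0 k0 pk hA hB.
pose TA := formulas 1 m.
pose TB := formulas D m.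
pose PA (u : TA) g := let w := head [::] (unpack u) in
  admissible w && (`|signed_sum (label_value g) w| <= Z)%N.
pose PB (u : TB) g := let ws := unpack u in
  [&& all admissible ws, pairwise (@disjoint_labels _) ws
    & constant [seq signed_sum (label_value g) w | w <- ws]].
have cA : (#|[pred g | [exists u, PA u g]]| * X <= #|TA| * (X ^ k * Z.*2.+1))%N.
  apply: card_exists_le => u; rewrite /PA /=; set w' := head _ _.
  have [aw|_] := boolP (admissible w'); last by rewrite eq_card0.
  exact: card_small_sum.
have cB : (#|[pred g | [exists u, PB u g]]| * X ^ D.-1 <= #|TB| * X ^ k)%N.
  apply: card_exists_le => u; rewrite /PB /=; set ws' := unpack u.
  have sws : size ws' = D by exact: size_unpack.
  have [aw|_] := boolP (all admissible ws'); last by rewrite eq_card0.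
  have [pw|_] := boolP (pairwise (@disjoint_labels _) ws'); last by rewrite eq_card0.
  by have := card_equal_sums aw pw; rewrite sws.
have X0 : (0 < X)%N by lia.
have Xk : (0 < X ^ k)%N by rewrite expn_gt0 X0.
have fA := card_formulas m 1 k0 pk; have fB := card_formulas m D k0 pk.
rewrite muln1 -/TA in fA; rewrite -/TB in fB.
(* Otherwise the two bad sets, each of less than half the size, cover everything. *)
have [g] : exists g, ~~ [exists u, PA u g] && ~~ [exists u, PB u g].
  apply/existsP; apply: contraT; rewrite negb_exists => /forallP bad.
  suff: (X ^ k <= #|[pred g | [exists u, PA u g]]| + #|[pred g | [exists u, PB u g]]|)%N.
    move: #|[pred g | [exists u, PA u g]]| #|[pred g | [exists u, PB u g]]| cA cB => a b.
    move: (X ^ k)%N (X ^ D.-1)%N (Z.*2.+1)%N Xk hA hB fA fB => T U z.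
    move: #|TA| #|TB| (_ ^ m)%N (_ ^ (m * D))%N => A B M N T0 hA hB fA fB ha hb ab.
    have ha' : (a * 2 < T)%N.
      rewrite -(ltn_pmul2r X0) mulnAC mulnC.
      apply: leq_ltn_trans (leq_mul (leqnn 2) (leq_trans ha (leq_mul fA (leqnn _)))) _.
      by move: hA; rewrite -(ltn_pmul2l T0); lia.
    have hb' : (b * 2 < T)%N.
      have U0 : (0 < U)%N by lia.
      rewrite -(ltn_pmul2r U0) mulnAC mulnC.
      apply: leq_ltn_trans (leq_mul (leqnn 2) (leq_trans hb (leq_mul fB (leqnn _)))) _.
      by move: hB; rewrite -(ltn_pmul2l T0); lia.
    lia.
  have <- : #|{: {ffun 'I_k -> 'I_X}}| = (X ^ k)%N by rewrite card_ffun !card_ord.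
  rewrite -cardUI (leq_trans _ (leq_addr _ _)) //.
  apply/subset_leq_card/fintype.subsetP => g _; have := bad g.
  by rewrite negb_and !negbK !inE.
case/andP=> /existsPn gA /existsPn gB; exists g; split.
  move=> w aw sw.
  have [|w1 /=|u uw] := @unpackP 1 m (size w) [:: w] k0 (erefl _).
  - by rewrite admissible_size.
  - by rewrite inE => /eqP ->.
  by have := gA u; rewrite /PA uw /= aw /= -ltnNge.
move=> ws l N sD lm wsP; apply/negP => dis.
case: ws => [|w0 ws] in sD wsP dis *.
  by rewrite -sD in D0.
have [aw0 sw0 _] := wsP _ (mem_head _ _).
have [||u uws] := @unpackP D m l (w0 :: ws) k0 sD.
- by rewrite -sw0 admissible_size //= sw0.
- by move=> w /wsP[].
have := gB u; rewrite /PB uws dis => /negP; apply; apply/and3P; split => //.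
  by apply/allP => w /wsP[].
have [_ _ e0] := wsP _ (mem_head _ _).
rewrite /= all_map; apply/allP => w wws /=.
have [|_ _ ->] := wsP w; first by rewrite inE wws orbT.
by rewrite e0.
Qed.

End RandomBlock.

(** * Blocks of integers *)

(** The order of the terms is left free, which changes the number of
    representations by a bounded factor only. *)
Definition is_rep (E : nat -> Prop) (l : nat) (N : int) (w : seq (bool * nat)) :=
  [/\ size w = l, uniq (unzip2 w), {in unzip2 w, forall a, E a}
    & signed_sum id w = N].

Definition fresh (F : seq nat) (w : seq (bool * nat)) : bool :=
  has (fun a => a \notin F) (unzip2 w).

(** The first clause keeps a block from contributing to small integers; the
    second bounds its contribution to any integer, by [good_block_hitting]. *)
Definition good_block (m D Z : nat) (F G : seq nat) : Prop :=
  let E := fun a : nat => a \in F ++ G in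
  (forall l N w, (l <= m)%N -> is_rep E l N w -> fresh F w -> (Z < `|N|)%N) /\
  (forall l N ws, (l <= m)%N -> size ws = D ->
     {in ws, forall w, is_rep E l N w /\ fresh F w} ->
     ~~ pairwise (@disjoint_labels _) ws).

(** Labels and values correspond bijectively: a coincidence between a new label
    and another one would be a formula of length two with sum [0], which is
    small. This is where [1 < m] is used. *)
Lemma good_block_exists (m D Z k X : nat) (F : seq nat) :
    (1 < m)%N -> (0 < D)%N -> (0 < k)%N -> uniq F -> (size F <= k)%N ->
    (2 * (m * (4 * k) ^ m) * Z.*2.+1 < X)%N ->
    (2 * (m * (4 * k) ^ (m * D)) < X ^ D.-1)%N ->
  exists G, [/\ size G = k, uniq (F ++ G), {in G, forall a, (0 < a <= X)%N}
    & good_block m D Z F G].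
Proof.
move=> m1 D0 k0 uF sF hA hB.
pose f (i : 'I_(size F)) := nth 0%N F i.
have [g [gA gB]] := @good_assignment (size F) k X f m D Z D0 k0 sF hA hB.
have vinj : injective (label_value f g).
  have new_neq x y : is_new x -> label_value f g x = label_value f g y -> x = y.
    move=> nx xy; apply/eqP; apply: contraT => neq.
    have aw : admissible [:: (false, x); (true, y)].
      by rewrite /admissible /= inE neq nx.
    have := gA _ aw m1; rewrite /signed_sum !big_cons big_nil /= xy.
    by rewrite expr0 expr1 mul1r mulN1r addr0 subrr.
  move=> [i|i] [j|j] //= e; last 3 first.
  - by apply/esym/new_neq => //; rewrite /= e.
  - exact: new_neq.
  - exact: new_neq.
  suff -> : i = j by [].
  by apply: val_inj; apply/eqP; rewrite -(nth_uniq 0%N _ _ uF) ?ltn_ord //; apply/eqP.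
have vF x : ~~ is_new x -> label_value f g x \in F.
  by case: x => //= i _; apply: mem_nth.
pose G := [seq (g i).+1 | i <- enum 'I_k].
have FG a : (a \in F ++ G) -> exists x, label_value f g x = a.
  rewrite mem_cat => /orP[aF|/mapP[i _ ->]]; last by exists (inr i).
  by have := aF; rewrite -index_mem => ia; exists (inl (Ordinal ia)); apply: nth_index.
pose lab a := odflt (inr (Ordinal k0)) [pick x | label_value f g x == a].
have labK a : a \in F ++ G -> label_value f g (lab a) = a.
  move=> /FG[x xa]; rewrite /lab; case: pickP => [y /eqP //|/(_ x)].
  by rewrite xa eqxx.
pose lw (w : seq (bool * nat)) := [seq (x.1, lab x.2) | x <- w].
have lwE w : {in unzip2 w, forall a, a \in F ++ G} ->
    map (label_value f g) (unzip2 (lw w)) = unzip2 w.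
  move=> wE; rewrite /lw /unzip2 -!map_comp; apply/eq_in_map => x xw /=.
  by rewrite labK // wE // map_f.
have lwP l N w : is_rep (fun a => a \in F ++ G) l N w -> fresh F w ->
    [/\ admissible (lw w), size (lw w) = l & signed_sum (label_value f g) (lw w) = N].
  move=> [sw uw wE Nw] fw; rewrite size_map; split => //; last first.
    rewrite signed_sum_map -Nw; apply: eq_signed_sum => a aw /=; exact/labK/wE.
  rewrite /admissible -(map_inj_uniq vinj) lwE // uw /=.
  case/hasP: fw => a aw aF; apply/hasP; exists (lab a).
    by case/mapP: aw => x xw ->; apply/mapP; exists (x.1, lab x.2) => //; apply: map_f.
  by apply: contraNT aF => /vF; rewrite labK // wE.
exists G; split.
- by rewrite size_map size_enum_ord.
- rewrite cat_uniq uF /= map_inj_uniq ?enum_uniq ?andbT; last first.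
    by move=> i j e; have [] := vinj (inr i) (inr j) e.
  apply/hasPn => _ /mapP[i _ ->]; apply/negP => /(nthP 0%N)[j jF e].
  by have := vinj (inl (Ordinal jF)) (inr i) e.
- by move=> _ /mapP[i _ ->]; rewrite /= ltn_ord.
split=> [l N w lm rw fw|l N ws lm sws wsP].
  by have [aw sw <-] := lwP _ _ _ rw fw; apply: gA; rewrite // sw.
have : ~~ pairwise (@disjoint_labels _) (map lw ws).
  apply: (gB _ l N); rewrite ?size_map // => _ /mapP[w /wsP[rw fw] ->].
  exact: lwP.
apply: contra => dis; rewrite pairwise_map; move: dis.
apply: (@sub_in_pairwise _ (mem ws)); last exact/allP.
move=> w w' /wsP[[_ _ wE _] _] /wsP[[_ _ wE' _] _] /=; apply: contra.
case/hasP=> x xw' xw; apply/hasP; exists (label_value f g x).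
  by rewrite -lwE // map_f.
by rewrite /= -lwE // map_f.
Qed.

(** * The sequence of blocks and its representations *)

Lemma block_sequence (m D : nat) (k X Z : nat -> nat) :
    (1 < m)%N -> (0 < D)%N -> (forall j, 0 < k j)%N ->
    (forall j, 2 * k j <= k j.+1)%N -> (forall j, X j <= X j.+1)%N ->
    (forall j, 2 * (m * (4 * k j) ^ m) * (Z j).*2.+1 < X j)%N ->
    (forall j, 2 * (m * (4 * k j) ^ (m * D)) < X j ^ D.-1)%N ->
  exists F G : nat -> seq nat,
    [/\ F 0 = [::], forall j, F j.+1 = F j ++ G j,
        forall j, [/\ size (G j) = k j, uniq (F j) & good_block m D (Z j) (F j) (G j)]
      & forall j, {in F j.+1, forall a, (0 < a <= X j)%N}].
Proof.
move=> m1 D0 k0 kk XX hA hB.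
(* A block depends on the union [F] of the previous ones and on its index. *)
have /choice[ext extP] : forall u : nat * seq nat, exists G : seq nat,
    uniq u.2 -> (size u.2 <= k u.1)%N ->
    [/\ size G = k u.1, uniq (u.2 ++ G), {in G, forall a, (0 < a <= X u.1)%N}
      & good_block m D (Z u.1) u.2 G].
  move=> [j F] /=; have [/andP[uF sF]|nF] := boolP (uniq F && (size F <= k j)%N).
    have [G GP] := good_block_exists m1 D0 (k0 j) uF sF (hA j) (hB j).
    by exists G.
  by exists [::] => uF sF; rewrite uF sF in nF.
pose F := fix F j := if j is i.+1 then F i ++ ext (i, F i) else [::].
pose G j := ext (j, F j).
have FS j : F j.+1 = F j ++ G j by [].
have FP j : uniq (F j) /\ (size (F j) <= k j)%N.
  elim: j => // j [uF sF]; have [sG uFG _ _] := extP (j, F j) uF sF.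
  by rewrite FS size_cat sG /=; split=> //; have := kk j; rewrite /= in sF *; lia.
have GP j : [/\ size (G j) = k j, uniq (F j ++ G j),
    {in G j, forall a, (0 < a <= X j)%N} & good_block m D (Z j) (F j) (G j)].
  by have [uF sF] := FP j; apply: (extP (j, F j)).
exists F, G; split => // [j|].
  by have [? _ _ ?] := GP j; split => //; case: (FP j).
elim=> [|j IH] a; rewrite FS mem_cat => /orP[aF|aG] //.
- by have [_ _ h _] := GP 0%N; apply: h.
- by have := IH a aF; have := XX j; lia.
- by have [_ _ h _] := GP j.+1; apply: h.
Qed.

(** The union of a maximal family of disjoint representations meets all of them,
    and such a family has fewer than [D] members. *)
Lemma good_block_hitting (m D Z : nat) (F G : seq nat) (l : nat) (N : int) :
    good_block m D Z F G -> (l <= m)%N ->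
  exists2 T : seq nat, (size T <= m * D)%N &
    forall w, is_rep (fun a => a \in F ++ G) l N w -> fresh F w ->
      has (mem T) (unzip2 w).
Proof.
move=> [_ gD] lm; apply: contrapT => noT.
have noT' (T : seq nat) : (size T <= m * D)%N -> exists w,
    [/\ is_rep (fun a => a \in F ++ G) l N w, fresh F w & ~~ has (mem T) (unzip2 w)].
  move=> sT; apply: contrapT => now; apply: noT; exists T => // w rw fw.
  by apply: contraT => Tw; case: now; exists w.
suff /(_ D (leqnn D)) [ws [sws wsP dis]] : forall d, (d <= D)%N -> exists ws,
    [/\ size ws = d,
        {in ws, forall w, is_rep (fun a => a \in F ++ G) l N w /\ fresh F w}
      & pairwise (@disjoint_labels _) ws].
  by have /negP := gD _ _ _ lm sws wsP.
elim=> [_|d IH dD]; first by exists [::].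
have [ws [sws wsP dis]] := IH (ltnW dD).
have [|w [rw fw wT]] := noT' (flatten (map (@unzip2 _ _) ws)).
  rewrite size_flatten /shape -map_comp sumnE big_map big_seq.
  under eq_bigr => w /wsP[[sw _ _ _] _] do rewrite /= size_map sw.
  rewrite -big_seq big_const_seq count_predT iter_addn_0 sws.
  by rewrite leq_mul // ltnW.
exists (w :: ws); split; rewrite /= ?sws // ?dis ?andbT.
  by move=> w'; rewrite inE => /predU1P[->|/wsP].
apply/allP => w' w'ws; apply: contra wT => /hasP[a aw' aw].
by apply/hasP; exists a => //; apply/flattenP; exists (unzip2 w') => //; apply: map_f.
Qed.

(** The classes [P u] may overlap. *)
Lemma size_le_classes (T U : eqType) (P : U -> pred T) (s : seq T)
    (keys : seq U) (M : nat) :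
    {in s, forall x, has (P^~ x) keys} -> {in keys, forall u, (count (P u) s <= M)%N} ->
  (size s <= size keys * M)%N.
Proof.
move=> sP PM; apply: (@leq_trans (\sum_(u <- keys) count (P u) s)%N).
  rewrite -sum1_size; under [leqRHS]eq_bigr do rewrite -sum1_count big_mkcond.
  rewrite exchange_big big_seq [leqRHS]big_seq; apply: leq_sum => x /sP.
  by rewrite -big_mkcond sum1_count has_count.
rewrite big_seq; apply: (@leq_trans (\sum_(u <- keys | u \in keys) M)%N).
  exact: leq_sum PM.
by rewrite -big_seq big_const_seq count_predT iter_addn_0 mulnC.
Qed.

(** Classify the representations by the position, the sign and the value of a
    term in the hitting set: within a class, deleting that term is injective and
    yields representations of a single integer by one term less. *)
Lemma rep_count_le (E : nat -> Prop) (m B : nat) :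
    (forall l N, (0 < l <= m)%N -> exists2 T : seq nat, (size T <= B)%N &
       forall w, is_rep E l N w -> has (mem T) (unzip2 w)) ->
  forall l N ws, (l <= m)%N -> uniq ws -> {in ws, forall w, is_rep E l N w} ->
    (size ws <= (m * (2 * B)) ^ l)%N.
Proof.
move=> hit; elim=> [|l IH] N ws lm uws wsP.
  suff /(uniq_leq_size uws) : {subset ws <= [:: [::]]} by [].
  by move=> w /wsP[/size0nil -> _ _ _]; rewrite inE.
have [T sT TP] := hit l.+1 N lm.
pose keys :=
  [seq (i, x) | i <- iota 0 l.+1, x <- [seq (b, a) | b <- [:: false; true], a <- T]].
pose x0 := (false, 0%N).
pose P (u : nat * (bool * nat)) (w : seq (bool * nat)) := nth x0 w u.1 == u.2.
rewrite expnS; apply: (@leq_trans (size keys * (m * (2 * B)) ^ l)); last first.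
  rewrite leq_mul2r; apply/orP; right.
  by rewrite /keys !size_allpairs size_iota leq_mul //= leq_mul.
apply: (@size_le_classes _ _ P).
  move=> w ww; have [sw _ _ _] := wsP w ww; have := TP w (wsP w ww).
  case/hasP=> _ /mapP[[b a] xw ->] /= aT; apply/hasP.
  exists (index (b, a) w, (b, a)); last by rewrite /P /= nth_index.
  apply: allpairs_f; first by rewrite mem_iota -sw index_mem.
  by apply: allpairs_f aT; case: (b).
case=> i x /allpairsP[[i' x'] [ii _ /= [ei ex]]]; subst i' x'.
rewrite mem_iota add0n /= in ii.
pose del (w : seq (bool * nat)) := take i w ++ drop i.+1 w.
have delE w : w \in seq.filter (P (i, x)) ws -> w = take i w ++ x :: drop i.+1 w.
  rewrite mem_filter => /andP[/eqP /= wi /wsP[sw _ _ _]].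
  by rewrite -wi -drop_nth ?sw // cat_take_drop.
have injdel : {in seq.filter (P (i, x)) ws &, injective del}.
  move=> w w' ww ww' e; have sw u : u \in seq.filter (P (i, x)) ws -> size u = l.+1.
    by rewrite mem_filter => /andP[_ /wsP[]].
  have := e; rewrite /del => /eqP; rewrite eqseq_cat; last first.
    by rewrite !size_take !sw.
  by case/andP=> /eqP e1 /eqP e2; rewrite (delE w ww) (delE w' ww') e1 e2.
rewrite -size_filter -(size_map del).
apply: (IH (N - (-1) ^+ x.1 * x.2%:Z)); first exact: ltnW.
  by rewrite map_inj_in_uniq // filter_uniq.
move=> _ /mapP[w ww ->]; have ew := delE w ww.
have : perm_eq w (x :: del w).
  by rewrite {1}ew /del -cat1s perm_catCA.
have [sw uw wE wN] : is_rep E l.+1 N w by move: ww; rewrite mem_filter => /andP[_ /wsP].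
move=> pw; have p2 : perm_eq (unzip2 w) (x.2 :: unzip2 (del w)) by apply: perm_map pw.
split.
- by have := perm_size pw; rewrite sw => -[].
- by have := perm_uniq p2; rewrite uw => /esym /andP[].
- by move=> a ad; apply: wE; rewrite (perm_mem p2) inE ad orbT.
- by rewrite -wN /signed_sum (perm_big _ pw) big_cons /= addrAC subrr add0r.
Qed.

(** The sets hitting the representations whose last block is [j] are collected
    over the window of the [j] with [Z j < |N| <= m * X j], which the hypothesis
    on [J] makes at most [J] long. *)
Lemma blocks_hitting (m D J : nat) (X Z : nat -> nat) (F G : nat -> seq nat) :
    F 0 = [::] -> (forall j, F j.+1 = F j ++ G j) ->
    (forall j, good_block m D (Z j) (F j) (G j)) ->
    (forall j, {in F j.+1, forall a, (0 < a <= X j)%N}) ->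
    (forall i j, i + J <= j -> m * X i <= Z j)%N ->
  forall l N, (0 < l <= m)%N -> exists2 T : seq nat, (size T <= J * (m * D))%N &
    forall w, is_rep (fun a => exists j, a \in F j) l N w -> has (mem T) (unzip2 w).
Proof.
move=> F0 FS gF XF window l N /andP[l0 lm].
have subF i j : (i <= j)%N -> {subset F i <= F j}.
  move=> /subnK <-; elim: (j - i)%N => [|d IH] a aF //.
  by rewrite addSn FS mem_cat IH.
(* The last block used: [F i.+1] is the first union containing the terms. *)
have top w : is_rep (fun a => exists j, a \in F j) l N w ->
    exists2 j, is_rep (fun a => a \in F j ++ G j) l N w & fresh (F j) w.
  move=> [sw uw wE wN].
  have [j wj] : exists j, all (mem (F j)) (unzip2 w).
    elim: (unzip2 w) wE => [|a s IH] sE; first by exists 0%N.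
    have [i ai] := sE a (mem_head _ _).
    have [|j sj] := IH; first by move=> b bs; apply: sE; rewrite inE bs orbT.
    exists (maxn i j); rewrite /= (subF i) ?leq_maxl //=.
    by apply/allP => b /(allP sj); apply: subF; rewrite leq_maxr.
  have exj : exists j, all (mem (F j)) (unzip2 w) by exists j.
  case: (ex_minnP exj) => -[|i] wi imin.
    by move: wi; rewrite F0; case: (w) sw l0 => //= <-.
  exists i; first by split => // a aw; rewrite -FS; apply: (allP wi).
  rewrite /fresh has_predC; apply/negP => h; have := imin i h; lia.
pose valid j := (Z j < `|N| <= m * X j)%N.
have topv w j : is_rep (fun a => a \in F j ++ G j) l N w -> fresh (F j) w -> valid j.
  move=> rw fw; have [h _] := gF j; rewrite /valid (h _ _ _ lm rw fw) /=.
  have [sw _ wE <-] := rw.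
  apply: (@leq_trans (size w * X j)); last by rewrite leq_mul2r sw lm orbT.
  by apply: absz_signed_sum_le => a /wE; rewrite -FS => /XF/andP[].
have /choice[T TP] : forall j, exists T : seq nat, (size T <= m * D)%N /\
    forall w, is_rep (fun a => a \in F j ++ G j) l N w -> fresh (F j) w ->
      has (mem T) (unzip2 w).
  by move=> j; have [T sT TP] := good_block_hitting N (gF j) lm; exists T.
have [exv|nov] := pselect (exists j, valid j); last first.
  by exists [::] => // w /top[j rw fw]; case: nov; exists j; apply: topv rw fw.
case: (ex_minnP exv) => j0 v0 minj0.
exists (flatten [seq T j | j <- iota j0 J]) => [|w /top[j rw fw]].
  rewrite size_flatten /shape -map_comp sumnE big_map.
  apply: (@leq_trans (\sum_(j <- iota j0 J) m * D)%N).
    by apply: leq_sum => j _; exact: (TP j).1.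
  by rewrite big_const_seq count_predT size_iota iter_addn_0 mulnC.
have vj := topv w j rw fw; have j0j := minj0 j vj.
have jJ : (j < j0 + J)%N.
  rewrite ltnNge; apply/negP => /window; move: v0 vj; rewrite /valid; lia.
have := (TP j).2 w rw fw; case/hasP=> a aw aT; apply/hasP; exists a => //.
apply/flattenP; exists (T j) => //; apply: map_f.
by rewrite mem_iota j0j.
Qed.

(** * Choice of the scales *)

(** The piecewise linear interpolation of [s * 2 ^ (j / s)] at the multiples of
    [s]: it grows by a factor at most [1 + 1 / s] at each step, and doubles
    exactly after [s] steps. *)
Definition block_exp (s j : nat) : nat := (2 ^ (j %/ s) * (s + j %% s))%N.

Lemma block_expS s j : (0 < s)%N ->
  block_exp s j.+1 = (block_exp s j + 2 ^ (j %/ s))%N.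
Proof.
move=> s0; rewrite /block_exp {1 2}(divn_eq j s) -addnS.
have := ltn_pmod j s0; rewrite leq_eqVlt => /predU1P[e|lt].
  by rewrite divnMDl // modnMDl e divnn modnn s0 addn1 expnS; lia.
by rewrite divnMDl // modnMDl (divn_small lt) (modn_small lt) addn0 addnS mulnS addnC.
Qed.

Lemma block_exp_ge s j : (s * 2 ^ (j %/ s) <= block_exp s j)%N.
Proof. by rewrite /block_exp mulnC leq_mul2l leq_addr orbT. Qed.

Lemma block_exp_gt0 s j : (0 < s)%N -> (0 < block_exp s j)%N.
Proof.
by move=> s0; apply: leq_trans (block_exp_ge s j); rewrite muln_gt0 s0 expn_gt0.
Qed.

Lemma block_exp_leq s : (0 < s)%N -> {homo block_exp s : i j / (i <= j)%N}.
Proof.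
move=> s0; apply: homo_leq => //; first exact: leq_trans.
by move=> j; rewrite block_expS // leq_addr.
Qed.

Lemma block_exp_double s i a : (0 < s)%N ->
  block_exp s (i + s * a) = (2 ^ a * block_exp s i)%N.
Proof.
move=> s0; rewrite /block_exp (addnC i) (mulnC s) divnMDl // modnMDl expnD; lia.
Qed.

(** With [D = 2 (m s + 2)] the family condition of [good_block_exists] reads, up
    to constants absorbed by [b],
    [q ^ (m s D + D / 2 + 1) <= q ^ ((m s + 1) (D - 1))].
    With [Z = q / b] the condition on small sums holds since [X = k ^ m * q].
    The exponents [e] double every [s] steps, so after [s (m s + 3)] blocks
    [q / b] is at least [m X]. The exponent [1 / m - eps] of the theorem appears as an
    inequality between integer powers. *)
Lemma bounded_rep_dense_set (m s : nat) : (1 < m)%N -> (0 < s)%N ->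
  exists (B : nat) (E : nat -> Prop),
  [/\ forall a, E a -> (0 < a)%N,
      forall N ws, uniq ws -> {in ws, forall w, is_rep E m N w} -> (size ws <= B)%N
    & exists n0, forall n, (n0 <= n)%N -> exists G : seq nat,
      [/\ uniq G, {in G, forall a, E a /\ (0 < a <= n)%N}
        & (n ^ (s * s) <= size G ^ ((m * s).+1 * s.+1))%N]].
Proof.
move=> m1 s0.
(* The base [b] is large enough to absorb [4 ^ m], [16 ^ m] and [8 m]. *)
pose e := block_exp s; pose b := (16 ^ m * (8 * m))%N.
pose D' := (m * s + 2)%N; pose D := (2 * D')%N.
pose q j := (b ^ e j)%N; pose k j := (q j ^ s)%N; pose X j := (q j ^ (m * s).+1)%N.
pose Z j := (b ^ (e j).-1)%N.
have b16 : (16 ^ m <= b)%N by rewrite /b leq_pmulr //; lia.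
have m16 : (0 < 16 ^ m)%N by rewrite expn_gt0.
have m4 : (0 < 4 ^ m)%N by rewrite expn_gt0.
have b8 : (8 * m <= b)%N by rewrite /b leq_pmull.
have b0 : (0 < b)%N by lia.
have b1 : (1 < b)%N by lia.
have e0 j : (0 < e j)%N by apply: block_exp_gt0.
have eS j : (e j < e j.+1)%N by rewrite /e block_expS // -ltn_subLR // subnn expn_gt0.
have qb j : (b <= q j)%N by rewrite -{1}(expn1 b) leq_exp2l.
have Xm i j : (i <= j)%N -> (X i <= X j)%N.
  by move=> ij; rewrite leq_exp2r // leq_exp2l // block_exp_leq.
have hA j : (2 * (m * (4 * k j) ^ m) * (Z j).*2.+1 < X j)%N.
  rewrite /k /X expnS mulnC expnMn -expnM (mulnC s m).
  rewrite [X in (_ < X)%N]mulnC; set Y := (q j ^ (m * s))%N.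
  have Y0 : (0 < Y)%N by rewrite expn_gt0; have := qb j; lia.
  have -> : q j = (b * Z j)%N by rewrite /q /Z -expnS prednK.
  have Z0 : (0 < Z j)%N by rewrite expn_gt0 b0.
  have b4 : (8 * m * 4 ^ m <= b)%N.
    by rewrite /b mulnC leq_mul2r leq_exp2r ?orbT //; lia.
  apply: (@leq_trans (Y * (8 * m * 4 ^ m * Z j))); last first.
    by rewrite leq_mul2l leq_mul2r b4 !orbT.
  set c := (4 ^ m)%N in m4 *.
  apply: (@leq_ltn_trans (Y * (6 * m * c * Z j))%N); nia.
have hB j : (2 * (m * (4 * k j) ^ (m * D)) < X j ^ D.-1)%N.
  have h4 : (4 ^ (m * D) <= q j ^ D')%N.
    rewrite /D mulnA expnM (mulnC m) expnM -[(4 ^ 2)%N]/16%N.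
    by rewrite leq_exp2r ?(leq_trans b16) // /D' addn2.
  rewrite /X /k; move: (q j) h4 (qb j) => Q h4 Qb; rewrite expnMn -!expnM.
  apply: (@leq_ltn_trans (2 * m * (Q ^ (D' + s * (m * D))))%N).
    by rewrite expnD (mulnA 2 m) leq_mul2l leq_mul2r h4 !orbT.
  apply: (@leq_trans (Q ^ (D' + s * (m * D)).+1)).
    by rewrite expnS ltn_mul2r expn_gt0; lia.
  by rewrite leq_exp2l ?(leq_trans b1) // /D /D'; nia.
have win i j : (i + s * (m * s + 3) <= j)%N -> (m * X i <= Z j)%N.
  move=> ij; apply: (@leq_trans (b ^ (1 + e i * (m * s).+1))).
    by rewrite expnD expn1 /X /q -expnM leq_mul2r; apply/orP; right; lia.
  rewrite leq_exp2l //; have := block_exp_leq s0 ij; rewrite block_exp_double // -/e.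
  have : (m * s + 3 < 2 ^ (m * s + 3))%N by apply: ltn_expl.
  have := e0 i; move: (2 ^ _)%N => t; nia.
have k0 j : (0 < k j)%N by rewrite expn_gt0; have := qb j; lia.
have kk j : (2 * k j <= k j.+1)%N.
  rewrite /k /q -!expnM; apply: (@leq_trans (b ^ (e j * s).+1)).
    by rewrite expnS leq_mul2r b1 orbT.
  by rewrite leq_exp2l //; have := eS j; nia.
have D0 : (0 < D)%N by rewrite /D /D'; lia.
have [F [G [F0 FS GP FX]]] :=
  block_sequence m1 D0 k0 kk (fun j => Xm _ _ (leqnSn j)) hA hB.
have hit := blocks_hitting F0 FS (fun j => let: And3 _ _ h := GP j in h) FX win.
exists ((m * (2 * (s * (m * s + 3) * (m * D)))) ^ m)%N, (fun a => exists j, a \in F j).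
split.
- by move=> a [[|j]]; [rewrite F0|move=> /FX/andP[]].
- move=> N ws; exact: (rep_count_le hit (leqnn m)).
exists (X 0%N) => n n0.
have [j Xj Xj1] : exists2 j, (X j <= n)%N & (n < X j.+1)%N.
  have Xj j : (X j <= n)%N -> (j <= n)%N.
    apply: leq_trans; elim: j => // j IH; apply: leq_ltn_trans IH _.
    rewrite /X /q -!expnM ltn_exp2l // ltn_mul2r; exact: eS.
  have exj : exists j, (X j <= n)%N by exists 0%N.
  have [j Xjn jmax] := ex_maxnP exj Xj.
  by exists j => //; rewrite ltnNge; apply/negP => /jmax; rewrite ltnn.
have [sG _ _] := GP j.
exists (G j); split.
- have [_] := GP j.+1; rewrite FS cat_uniq => /and3P[] //.
- move=> a aG; have aF : a \in F j.+1 by rewrite FS mem_cat aG orbT.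
  split; first by exists j.+1.
  by have := FX j a aF; lia.
rewrite sG; apply: (@leq_trans (X j.+1 ^ (s * s))).
  by rewrite leq_exp2r ?muln_gt0 ?s0 // ltnW.
rewrite /X /k /q -!expnM leq_exp2l //.
have : (s * e j.+1 <= s.+1 * e j)%N.
  by rewrite /e block_expS // mulnDr mulSn addnC leq_add2r block_exp_ge.
by rewrite -(leq_pmul2r (_ : 0 < (m * s).+1 * s)%N) ?muln_gt0 ?s0 //; lia.
Qed.

(** * Extended-real counts and real exponents *)

Lemma counting_le (R : realType) (T : choiceType) (A : set T) (B : nat) :
    (forall s : seq T, uniq s -> {in s, forall x, A x} -> (size s <= B)%N) ->
  (counting A <= B%:R%:E :> \bar R)%E.
Proof.
move=> AB; have finA : finite_set A.
  apply: contrapT => infA.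
  have [S SA SB] := infinite_set_fset B.+1 infA.
  have := AB S (fset_uniq S) (fun x xS => SA x xS).
  by rewrite leqNgt SB.
rewrite /counting; case: asboolP => // _.
rewrite lee_fin ler_nat; apply: AB; first exact: fset_uniq.
by move=> x; rewrite in_fset_set // inE.
Qed.

Definition signed_seq (m t : nat) (a : {ffun 'I_m -> nat}) : seq (bool * nat) :=
  [seq ((t <= i)%N, a i) | i : 'I_m <- enum 'I_m].

Lemma signed_seq_inj (m t : nat) : injective (@signed_seq m t).
Proof.
move=> a a' /eq_in_map e; apply/ffunP => i.
by have [] := e i (mem_enum _ i).
Qed.

Lemma signed_seq_rep (m t : nat) (E : set nat) (N : int) (a : {ffun 'I_m -> nat}) :
  repr_tuples m t E N a -> is_rep E m N (signed_seq t a).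
Proof.
move=> [aE aN _ _ aneq].
have u2 : unzip2 (signed_seq t a) = map a (enum 'I_m) by rewrite /unzip2 -map_comp.
split.
- by rewrite size_map size_enum_ord.
- rewrite u2 map_inj_uniq ?enum_uniq // => i j aij; apply/eqP.
  by apply: contraT => /aneq; rewrite aij eqxx.
- by rewrite u2 => _ /mapP[i _ ->].
rewrite -aN /signed_sum big_map big_enum /= (bigID (fun i : 'I_m => (i < t)%N)) /=.
congr (_ + _); first by apply: eq_bigr => i it; rewrite leqNgt it expr0 mul1r.
rewrite -sumrN; apply: eq_big => [i|i]; rewrite -leqNgt // => ->.
by rewrite expr1 mulN1r.
Qed.

Lemma repr_count_lt (R : realType) (m B : nat) (E : set nat) (N : int) :
    (forall ws, uniq ws -> {in ws, forall w, is_rep E m N w} -> (size ws <= B)%N) ->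
  (repr_count R m E N < ((m.+1 * B).+1)%:R%:E)%E.
Proof.
move=> EB; apply: (@le_lt_trans _ _ ((m.+1 * B)%:R%:E)); last first.
  by rewrite lte_fin ltr_nat.
rewrite /repr_count; apply: (@le_trans _ _ (\sum_(t < m.+1) B%:R%:E)%E).
  apply: lee_sum => t _; apply: counting_le => s us sA.
  rewrite -(size_map (signed_seq t)); apply: EB.
    by rewrite map_inj_uniq //; apply: signed_seq_inj.
  by move=> _ /mapP[a /sA aA ->]; apply: signed_seq_rep.
by rewrite sumEFin lee_fin sumr_const card_ord mulnC mulrnA.
Qed.

Lemma initial_card_ge (E : set nat) (n : nat) (G : seq nat) :
    uniq G -> {in G, forall a, E a /\ (0 < a <= n)%N} ->
  (size G <= initial_card E n)%N.
Proof.
move=> uG GE; rewrite /initial_card.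
have fin : finite_set (E `&` [set k | (1 <= k <= n)%N]).
  apply: (@sub_finite_set _ _ `I_n.+1); last exact: finite_II.
  by move=> k [_ /= /andP[_]]; rewrite ltnS.
apply: uniq_leq_size => // a /GE aE; rewrite in_fset_set // inE; exact: aE.
Qed.

Lemma powR_le_of_expn_le (R : realType) (n g a b : nat) (x : R) :
    (0 < n)%N -> (0 < b)%N -> (n ^ a <= g ^ b)%N -> x <= a%:R / b%:R ->
  n%:R `^ x <= g%:R :> R.
Proof.
move=> n0 b0 ng xab; apply: (@le_trans _ _ (n%:R `^ (a%:R / b%:R))).
  by apply: ler_powR => //; rewrite ler1n.
rewrite -(ler_pXn2r b0) ?nnegrE ?powR_ge0 //.
rewrite -powR_mulrn ?powR_ge0 // -powRrM divfK ?pnatr_eq0 -?lt0n //.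
by rewrite powR_mulrn // -!natrX ler_nat.
Qed.

(** The gap between [1 / m] and the exponent reached is
    [(m s + s + 1) / (m (m s + 1) (s + 1)) <= 2 / (s + 1)]. *)
Lemma exponent_close (R : realType) (m : nat) (eps : R) : (0 < m)%N -> 0 < eps ->
  exists2 s : nat, (0 < s)%N &
    m%:R^-1 - eps <= (s * s)%:R / ((m * s).+1 * s.+1)%:R.
Proof.
move=> m0 eps0; pose s := (Num.truncn (2 / eps)).+1.
exists s => //.
have seps : 2 <= eps * s%:R by rewrite -ler_pdivrMl // mulrC ltW // truncnS_gt.
have m0' : 1 <= m%:R :> R by rewrite ler1n.
have s0' : 1 <= s%:R :> R by rewrite ler1n.
rewrite !natrM -(natr1 (m * s)) -(natr1 s) natrM.
move: (m%:R) (s%:R) m0' s0' seps => M S M1 S1 Se.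
have MS1 : 1 <= M * S by rewrite mulr_ege1.
have den0 : 0 < M * ((M * S + 1) * (S + 1)) by rewrite !mulr_gt0 //; lra.
rewrite lerBlDr -lerBlDl.
have -> : M^-1 - S * S / ((M * S + 1) * (S + 1)) =
    (M * S + S + 1) / (M * ((M * S + 1) * (S + 1))).
  by field; rewrite !gt_eqF //; lra.
rewrite ler_pdivrMr //; set P := M * S + 1 in den0 *.
have SP : S <= P by rewrite /P; nra.
apply: (@le_trans _ _ (2 * P)); first by rewrite /P in SP *; lra.
have -> : eps * (M * (P * (S + 1))) = (eps * (S + 1)) * (M * P) by ring.
apply: ler_pM; rewrite ?ler_peMl //; lra.
Qed.

Theorem theorem1p3 (R : realType) (m : nat) (hm : (2 <= m)%N)
    (eps : R) (heps : 0 < eps) :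
  exists (K : R) (E : set nat),
    [/\ E `<=` [set k | (1 <= k)%N],
        forall N : int, (repr_count R m E N < K%:E)%E
      & exists (c : R) (n0 : nat), 0 < c /\
          forall n : nat, (n0 <= n)%N ->
            c * n%:R `^ (m%:R^-1 - eps) <= (initial_card E n)%:R].
Proof.
have [s s0 sm] := exponent_close (ltnW hm) heps.
have [B [E [Epos EB [n0 En]]]] := bounded_rep_dense_set hm s0.
exists (m.+1 * B).+1%:R, E; split => //.
  by move=> N; apply: repr_count_lt => ws uws; apply: EB.
exists 1, n0.+1; split => // n n0n; rewrite mul1r.
have [G [uG GE nG]] := En n (ltnW n0n).
apply: (@le_trans _ _ (size G)%:R); last by rewrite ler_nat initial_card_ge.
by apply: powR_le_of_expn_le nG sm => //; apply: leq_ltn_trans n0n.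
Qed.
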